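(* Let $1\le m\le n$ be integers, let $\Phi$ be a (not necessarily symmetric) measurable kernel of $m$ arguments with $-1\le\Phi\le 1$, and let $z_1,\dots,z_n$ be a given sample. Let $d$ be a positive integer, and let $\mathscr{T}^\ast$ consist of $N=10^{2d+1}$ random ordered size-$m$ subsets of $\{1,\dots,n\}$ drawn independently from the uniform distribution $Q$. Then, with probability at least $1-2\exp(-5)$ with respect to the random draws, the incomplete U-statistic $\Phi(\mathscr{T}^\ast)$ determines the complete U-statistic $\Phi(\mathscr{T}_{\max})$ up to $d$ digits after the decimal point, in the sense that $$\bigl|\Phi(\mathscr{T}^\ast)-\Phi(\mathscr{T}_{\max})\bigr|<10^{-d}.$$
   Context: An ordered size-$m$ subset of $\{1,\dots,n\}$ is a tuple $T=(i_1,\dots,i_m)$ of pairwise distinct indices in $\{1,\dots,n\}$ (no monotonicity required); write $\Phi(T)=\Phi(z_{i_1},\dots,z_{i_m})$. $\mathscr{T}_{\max}$ is the collection of all ordered size-$m$ subsets, and $Q$ is the uniform distribution on $\mathscr{T}_{\max}$. For a finite collection $\mathscr{T}$ of ordered size-$m$ subsets (counted with repetition), $\Phi(\mathscr{T})=\frac{1}{|\mathscr{T}|}\sum_{T\in\mathscr{T}}\Phi(T)$. $\Phi(\mathscr{T}_{\max})$ is the complete U-statistic and $\Phi(\mathscr{T}^\ast)$ the incomplete one with random design. The number of iterations is the number $N$ of independent draws. *)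

(* Defs.v *)
From HB Require Import structures.
From mathcomp Require Import all_boot all_order all_algebra.
From mathcomp Require Import all_classical all_reals all_analysis.

Set Implicit Arguments.
Unset Strict Implicit.
Unset Printing Implicit Defensive.

Import Order.TTheory GRing.Theory Num.Theory.
Import numFieldNormedType.Exports.

Local Open Scope classical_set_scope.
Local Open Scope ring_scope.

(* Indices run over {0, ..., n-1}; the order of the entries matters and they
   need not be increasing. *)
Notation ordered_subset m n := {t : m.-tuple 'I_n | uniq t}.

Definition ordered_subsets (m n : nat) : seq (ordered_subset m n) :=
  enum {: ordered_subset m n}.

Section UStatistics.
Context {dZ : measure_display} {Z : measurableType dZ} {R : realType}.
Variables (m n : nat) (Phi : m.-tuple Z -> R) (z : n.-tuple Z).

Definition kernel_at (T : ordered_subset m n) : R :=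
  Phi (map_tuple (tnth z) (val T)).

(* A sequence is used as a collection so that repetitions are counted. *)
Definition Ustat (s : seq (ordered_subset m n)) : R :=
  (size s)%:R^-1 * \sum_(T <- s) kernel_at T.

Definition complete_Ustat : R := Ustat (ordered_subsets m n).

Definition incomplete_Ustat (N : nat) (T : 'I_N -> ordered_subset m n) : R :=
  Ustat [seq T k | k <- enum 'I_N].

End UStatistics.

(* A [measurableType] must be pointed, which [ordered_subset m n] is not when
   n < m. So random elements of a finite type X are treated directly, X being
   understood with the discrete sigma-algebra. *)
Section FiniteRandomElements.
Context {dO : measure_display} {Omega : measurableType dO} {R : realType}.
Variables (P : probability Omega R) (X : finType).

Definition random_element (T : Omega -> X) : Prop :=
  forall A : {set X}, measurable (T @^-1` [set` A]).

Definition uniform_on (A : {set X}) : R := #|A|%:R / #|X|%:R.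

Definition has_distribution (Q : {set X} -> R) (T : Omega -> X) : Prop :=
  forall A : {set X}, P (T @^-1` [set` A]) = (Q A)%:E.

Definition mutually_independent (I : finType) (T : I -> Omega -> X) : Prop :=
  forall (J : {set I}) (A : I -> {set X}),
    P (\bigcap_(k in [set` J]) (T k @^-1` [set` A k])) =
    (\prod_(k in J) P (T k @^-1` [set` A k]))%E.

Definition iid_uniform_draws (N : nat) (T : 'I_N -> Omega -> X) : Prop :=
  [/\ forall k, random_element (T k),
      forall k, has_distribution uniform_on (T k)
    & mutually_independent T].

End FiniteRandomElements.

(* Main.v *)
(* Hoeffding's inequality. The draws are uniform on a finite set X, so an event
   about them has probability (number of N-tuples in it) / |X|^N, and the Chernoff
   bound becomes a weighted count of tuples in which the exponential moment
   factors. By convexity, a variable in [-1, 1] with mean mu has its exponential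
   moment at s bounded by that of the two-point law on {-1, 1} with mean mu, hence
   by exp (s mu + s^2 / 2). Taking s = 10^-d and N = 10^(2d+1), each tail has
   probability at most exp (- N s^2 / 2) = exp (-5). *)
Require Import Defs.
From mathcomp Require Import all_boot all_order all_algebra ring lra.
From mathcomp Require Import all_classical all_reals all_analysis.

Set Implicit Arguments.
Unset Strict Implicit.
Unset Printing Implicit Defensive.

Import Order.TTheory GRing.Theory Num.Theory.
Import numFieldNormedType.Exports.

Local Open Scope classical_set_scope.
Local Open Scope ring_scope.

(** Mean value theorem. The sign of [df] is required only to the right of [x], since one of the
    signs used below is known only for nonnegative arguments. *)
Lemma is_derive_ge0_le (R : realType) (f df : R -> R) (x y : R) :
  (forall t : R, is_derive t (1 : R) f (df t)) -> (forall t, x <= t -> 0 <= df t) ->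
  x <= y -> f x <= f y.
Proof.
move=> fdf df_ge0 le_xy.
have [|c /andP[xc _] fE] := @MVT_segment R f df x y le_xy (fun t _ => fdf t).
  apply: continuous_subspaceT => t.
  by apply: differentiable_continuous; apply/derivable1_diffP; case: (fdf t).
by rewrite -subr_ge0 fE mulr_ge0 ?subr_ge0// df_ge0.
Qed.

(** Convexity of exp: [s * x] is the combination of [s] and [- s] with weights [(1 + x) / 2] and
    [(1 - x) / 2]. *)
Lemma expR_le_chord (R : realType) (s x : R) : -1 <= x <= 1 ->
  expR (s * x) <= (1 + x) / 2 * expR s + (1 - x) / 2 * expR (- s).
Proof.
move=> /andP[x_geN1 x_le1].
have t0 : 0 <= (1 + x) / 2 by lra.
have t1 : (1 + x) / 2 <= 1 by lra.
have := convex_expR (Itv01 t0 t1) s (- s).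
rewrite !convRE /= /unstable.onem.
have -> : 1 - (1 + x) / 2 = (1 - x) / 2 by field.
by have -> : (1 + x) / 2 * s + (1 - x) / 2 * - s = s * x by field.
Qed.

Section HoeffdingLemma.
Context {R : realType}.
Variable mu : R.
Hypothesis mu_itv : -1 <= mu <= 1.

(** Moment generating function of the law on {-1, 1} with mean [mu]; [K] is its derivative, and [M]
    is in turn that of [K]. *)
Let M (s : R) := (1 + mu) / 2 * expR s + (1 - mu) / 2 * expR (- s).
Let K (s : R) := (1 + mu) / 2 * expR s - (1 - mu) / 2 * expR (- s).

Let M_gt0 s : 0 < M s.
Proof.
rewrite /M; case/andP: mu_itv => h1 h2.
have := expR_gt0 s; have := expR_gt0 (- s).
by move: (expR s) (expR (- s)) => a b b0 a0; nra.
Qed.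

Let is_derive_M s : is_derive s (1 : R) M (K s).
Proof. by apply: is_derive_eq; rewrite /K /GRing.scale /=; ring. Qed.

Let is_derive_K s : is_derive s (1 : R) K (M s).
Proof. by apply: is_derive_eq; rewrite /M /GRing.scale /=; ring. Qed.

(* The derivative of K / M is 1 - (K / M)^2 <= 1; K / M is itself the derivative
   of ln M, hence the bound on M below. *)
Let K_div_M_le (s : R) : 0 <= s -> K s / M s <= mu + s.
Proof.
move=> s_ge0; rewrite -subr_ge0.
pose v (t : R) := mu + t - K t / M t.
have M0 : M 0 = 1 by rewrite /M oppr0 expR0; field.
have K0 : K 0 = mu by rewrite /K oppr0 expR0; field.
have v0 : v 0 = 0 by rewrite /v M0 K0; field.
suff : v 0 <= v s by rewrite v0.
apply: (@is_derive_ge0_le R v (fun t => (K t / M t) ^+ 2) 0 s _ _ s_ge0) => t;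
  last by move=> _; exact: sqr_ge0.
have Mn0 : M t != 0 by rewrite gt_eqF.
have dV := is_deriveV Mn0 (is_derive_M t).
apply: is_derive_eq; rewrite /GRing.scale /=.
rewrite mulrN1 mulrN opprK -/(M t); field.
exact: Mn0.
Qed.

(** After taking logarithms, the gap between the two sides vanishes at 0 and has derivative
    [mu + t - K t / M t], nonnegative by [K_div_M_le]. *)
Lemma hoeffding_two_point_mgf (s : R) : 0 <= s ->
  (1 + mu) / 2 * expR s + (1 - mu) / 2 * expR (- s) <=
  expR (s * mu + s ^+ 2 / 2).
Proof.
move=> s_ge0; rewrite -/(M s) -[M s]lnK ?posrE// ler_expR -subr_ge0.
pose h (t : R) := t * mu + t ^+ 2 / 2 - ln (M t).
have h0 : h 0 = 0.
  rewrite /h (_ : M 0 = 1); last by rewrite /M oppr0 expR0; field.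
  by rewrite ln1; field.
suff : h 0 <= h s by rewrite h0.
apply: (@is_derive_ge0_le R h (fun t => mu + t - K t / M t) 0 s _ _ s_ge0) => t;
  last by move=> t0; rewrite subr_ge0 K_div_M_le.
have dln := is_derive1_comp (is_derive1_ln (M_gt0 t)) (is_derive_M t).
apply: is_derive_eq; rewrite /GRing.scale /=; field.
by rewrite gt_eqF.
Qed.

End HoeffdingLemma.

(** The chord bound is affine in [f x], so averaging it over [X] leaves the two-point law with the
    same mean. *)
Lemma hoeffding_mgf (R : realType) (X : finType) (f : X -> R) (s : R) :
  (forall x, -1 <= f x <= 1) -> (0 < #|X|)%N -> 0 <= s ->
  \sum_x expR (s * f x) <=
  #|X|%:R * expR (s * (#|X|%:R^-1 * \sum_x f x) + s ^+ 2 / 2).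
Proof.
move=> f_itv X_gt0 s_ge0.
have cX_gt0 : 0 < #|X|%:R :> R by rewrite ltr0n.
have cX_neq0 : #|X|%:R != 0 :> R by rewrite gt_eqF.
set mu := _^-1 * _.
have muE : \sum_x f x = #|X|%:R * mu by rewrite mulVKf.
have mu_itv : -1 <= mu <= 1.
  rewrite -(ler_pM2l cX_gt0) -[mu <= 1](ler_pM2l cX_gt0) -muE mulrN mulr1.
  rewrite -sumr_const -sumrN !ler_sum// => x _; by case/andP: (f_itv x).
apply: (@le_trans _ _
    (\sum_x ((1 + f x) / 2 * expR s + (1 - f x) / 2 * expR (- s)))).
  by apply: ler_sum => x _; exact: expR_le_chord.
apply: (@le_trans _ _ (#|X|%:R * ((1 + mu) / 2 * expR s +
    (1 - mu) / 2 * expR (- s)))); last first.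
  by rewrite ler_pM2l// hoeffding_two_point_mgf.
rewrite big_split -!mulr_suml !big_split/= sumrN !sumr_const muE.
by rewrite le_eqVlt; apply/orP; left; apply/eqP; field.
Qed.

(** Chernoff bound with parameter [s = e], the minimizer of [s ^+ 2 / 2 - s * e]. *)
Lemma hoeffding_count (R : realType) (X : finType) (N : nat) (f : X -> R)
    (e : R) :
  (forall x, -1 <= f x <= 1) -> (0 < #|X|)%N -> 0 <= e ->
  #|[pred t : {ffun 'I_N -> X} | N%:R * (#|X|%:R^-1 * \sum_x f x + e)
       <= \sum_k f (t k)]|%:R <=
  #|X|%:R ^+ N * expR (- (N%:R * e ^+ 2 / 2)).
Proof.
move=> f_itv X_gt0 e_ge0; set mu := _^-1 * _.
have mgf := hoeffding_mgf f_itv X_gt0 e_ge0; rewrite -/mu in mgf.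
rewrite -sum1_card natr_sum big_mkcond/=.
(* The indicator of the event is at most this exponential weight, which is at least 1 on the event
   and nonnegative off it. *)
apply: (@le_trans _ _ (\sum_(t : {ffun 'I_N -> X})
    expR (- (N%:R * (e * (mu + e)))) * \prod_k expR (e * f (t k)))).
  apply: ler_sum => t _; rewrite inE; case: ifPn => [large|_]; last first.
    by rewrite mulr_ge0 ?expR_ge0// prodr_ge0// => k _; exact: expR_ge0.
  rewrite -expR_sum -expRD -[leLHS]expR0 ler_expR -mulr_sumr.
  by rewrite addrC subr_ge0 mulrCA ler_wpM2l.
(* Distributivity: the sum over tuples of products is the [N]-th power of a sum over [X]. *)
rewrite -mulr_sumr -(bigA_distr_bigA (fun=> fun x => expR (e * f x)))/=.
rewrite prodr_const card_ord.
apply: (@le_trans _ _ (expR (- (N%:R * (e * (mu + e)))) *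
    (#|X|%:R * expR (e * mu + e ^+ 2 / 2)) ^+ N)).
  rewrite ler_wpM2l ?expR_ge0// lerXn2r ?nnegrE//.
  by rewrite sumr_ge0// => x _; exact: expR_ge0.
rewrite exprMn -expRM_natl mulrCA -expRD ler_wpM2l ?exprn_ge0//.
by rewrite ler_expR; rewrite le_eqVlt; apply/orP; left; apply/eqP; field.
Qed.

Section Draws.
Context {dO : measure_display} {Omega : measurableType dO} {R : realType}.
Variables (P : probability Omega R) (X : finType) (N : nat).
Variable T : 'I_N -> Omega -> X.
Hypothesis T_draws : iid_uniform_draws P T.

(** The event that the draws are exactly [t], written as an intersection over all indices to match
    the form of [mutually_independent]. *)
Let cylinder (t : {ffun 'I_N -> X}) : set Omega :=
  \bigcap_(k in [set` [set: 'I_N]%SET]) (T k @^-1` [set` finset.set1 (t k)]).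

Let cylinderP t w : cylinder t w <-> [ffun k => T k w] = t.
Proof.
split=> [tw|<- k _ /=]; last by rewrite ffunE finset.in_set1.
apply/ffunP => k; rewrite ffunE; apply/eqP.
by have := tw k; rewrite /= !inE; apply.
Qed.

Let draws_eventE (A : {pred {ffun 'I_N -> X}}) :
  [set w | [ffun k => T k w] \in A] = \bigcup_(t in [set` A]) cylinder t.
Proof.
apply/seteqP; split=> w /=.
  by move=> Aw; eexists; [exact: Aw|exact/cylinderP].
by case=> t /= At /cylinderP ->.
Qed.

Let measurable_cylinder t : measurable (cylinder t).
Proof.
case: T_draws => mT _ _; apply: fin_bigcap_measurable => // k _.
exact: mT.
Qed.

Lemma measurable_draws_event (A : {pred {ffun 'I_N -> X}}) :
  measurable [set w | [ffun k => T k w] \in A].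
Proof. by rewrite draws_eventE; exact: fin_bigcup_measurable. Qed.

(** The event is a finite disjoint union of cylinders, each of probability [#|X|%:R ^- N] by
    independence and uniformity. *)
Lemma probability_draws_event (A : {pred {ffun 'I_N -> X}}) :
  P [set w | [ffun k => T k w] \in A] = (#|A|%:R / #|X|%:R ^+ N)%:E.
Proof.
rewrite draws_eventE measure_fin_bigcup//; last first.
  by move=> t u _ _ [w [/cylinderP <- /cylinderP <-]].
case: T_draws => _ unif indep.
have PE t : P (cylinder t) = (#|X|%:R ^- N)%:E.
  rewrite indep (eq_bigr (fun=> (#|X|%:R^-1)%:E)); last first.
    by move=> k _; rewrite unif /uniform_on cards1 mul1r.
  rewrite prodEFin; congr EFin.
  by rewrite prodr_const cardsT card_ord exprVn.
have -> : [set` A] = [set` enum A].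
  by apply/seteqP; split=> t /=; rewrite mem_enum.
rewrite -fsbig_seq ?enum_uniq// (eq_bigr _ (fun t _ => PE t)) sumEFin.
by rewrite big_enum/= sumr_const mulr_natl.
Qed.

End Draws.

Theorem corollary5p1 (R : realType)
  (m n : nat) (m_ge1 : (1 <= m)%N) (m_le_n : (m <= n)%N)
  (dZ : measure_display) (Z : measurableType dZ)
  (Phi : m.-tuple Z -> R)
  (Phi_meas : measurable_fun [set: m.-tuple Z] Phi)
  (Phi_bounded : forall x : m.-tuple Z, -1 <= Phi x <= 1)
  (z : n.-tuple Z)
  (d : nat) (d_gt0 : (0 < d)%N)
  (dO : measure_display) (Omega : measurableType dO) (P : probability Omega R)
  (T : 'I_(10 ^ (2 * d + 1)) -> Omega -> ordered_subset m n)
  (T_draws : iid_uniform_draws P T) :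
  ((1 - 2 * expR (- 5))%R%:E <=
    P [set w | (`|incomplete_Ustat Phi z (fun k => T k w)
                  - complete_Ustat Phi z| < 10 ^- d)%R])%E.
Proof.
pose X : finType := ordered_subset m n.
have X_gt0 : (0 < #|X|)%N.
  (* The tuple (0, ..., m-1) is a member of [X], as [m <= n]. *)
  have u : uniq (map_tuple (widen_ord m_le_n) (ord_tuple m)).
    by rewrite map_inj_uniq ?enum_uniq// => i j /(congr1 val) /= /val_inj.
  by apply/card_gt0P; exists (@exist _ (fun t : m.-tuple _ => is_true (uniq t)) _ u).
set N := (10 ^ (2 * d + 1))%N in T T_draws *.
pose f (x : X) : R := Phi (map_tuple (tnth z) (val x)).
have f_itv x : -1 <= f x <= 1 by exact: Phi_bounded.
set mu : R := complete_Ustat Phi z.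
have muE : mu = #|X|%:R^-1 * \sum_x f x.
  by rewrite /mu /complete_Ustat /Ustat /ordered_subsets -cardE big_enum.
have N_gt0 : 0 < N%:R :> R by rewrite ltr0n expn_gt0.
pose e : R := 10 ^- d.
have e_ge0 : 0 <= e by rewrite invr_ge0 exprn_ge0.
(* 10^(2d+1) * 10^(-2d) / 2 = 5. *)
have NeE : - (N%:R * e ^+ 2 / 2) = - 5 :> R.
  have q : (10 : R) ^+ d != 0 by rewrite expf_neq0// pnatr_eq0.
  by rewrite /N /e natrX exprD expr1 mulnC exprM; field.
pose far : {pred {ffun 'I_N -> X}} := [pred t : {ffun 'I_N -> X} |
  e <= `|N%:R^-1 * \sum_k f (t k) - mu|].
have far_card : #|far|%:R <= #|X|%:R ^+ N * (2 * expR (- 5)) :> R.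
  (* The lower tail of [f] is the upper tail of [- f], whose mean is [- mu]; one bound thus serves
     both tails. *)
  pose up (g : X -> R) := [pred t : {ffun 'I_N -> X} |
    N%:R * (#|X|%:R^-1 * \sum_x g x + e) <= \sum_k g (t k)].
  have far_sub : far \subset [predU up f & up (fun x => - f x)].
    apply/fintype.subsetP => t; rewrite !inE !sumrN mulrN -muE.
    rewrite -!(ler_pdivlMl _ _ N_gt0) mulrN ler_normr => /orP[] far_t;
      apply/orP; [left|right]; lra.
  have up_card g : (forall x, -1 <= g x <= 1) ->
      #|up g|%:R <= #|X|%:R ^+ N * expR (- 5) :> R.
    by move=> g_itv; rewrite -NeE; exact: hoeffding_count.
  have up_f := up_card _ f_itv.
  have up_Nf : #|up (fun x => - f x)|%:R <= #|X|%:R ^+ N * expR (- 5) :> R.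
    by apply: up_card => x; case/andP: (f_itv x) => ? ?; apply/andP; split; lra.
  (* Union bound, giving the factor 2. *)
  apply: (@le_trans _ _ (#|up f| + #|up (fun x => (- f x)%R)|)%:R).
    by rewrite ler_nat -cardUI (leq_trans (subset_leq_card far_sub))// leq_addr.
  by rewrite natrD; lra.
have farE w : ([ffun k => T k w] \in far) =
    (e <= `|incomplete_Ustat Phi z (fun k => T k w) - mu|).
  rewrite inE /incomplete_Ustat /Ustat size_map size_enum_ord big_map big_enum.
  by congr (_ <= `|_ * _ - _|); apply: eq_bigr => k _; rewrite ffunE.
have -> : [set w | (`|incomplete_Ustat Phi z (fun k => T k w) - mu| < e)%R] =
    ~` [set w | [ffun k => T k w] \in far].
  by apply/seteqP; split=> w; rewrite /= farE ltNge => /negP.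
rewrite probability_setC; last exact: (measurable_draws_event T_draws).
rewrite (probability_draws_event T_draws) -EFinB lee_fin lerB//.
by rewrite ler_pdivrMr ?exprn_gt0 ?ltr0n// mulrC.
Qed.
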